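(* Every linearly recurrent subshift $(X,T)$ is uniquely ergodic, i.e. there is exactly one $T$-invariant Borel probability measure on $X$.
   Context: A subshift on a finite alphabet $A$ is a pair $(X,T)$ with $X\subset A^{\mathbb Z}$ closed and $T(X)=X$, $T$ being the shift $(x_n)_n\mapsto(x_{n+1})_n$; it is minimal if it has no proper non-empty closed $T$-invariant subset. Linearly recurrent: let $x\in A^{\mathbb Z}$ and let $L(x)$ be the set of finite words occurring in $x$. For a non-empty $u\in L(x)$, a return word to $u$ of $x$ is a word $w$ such that $wu\in L(x)$, $u$ is a prefix of $wu$, and $u$ has exactly two occurrences in $wu$. The sequence $x$ is uniformly recurrent if for each word of $L(x)$ the differences between successive occurrences in $x$ are bounded. $x$ is linearly recurrent (LR) with constant $K\in\mathbb N$ if it is uniformly recurrent and $|w|\le K|u|$ for every non-empty $u\in L(x)$ and every return word $w$ to $u$ of $x$. A subshift is linearly recurrent if it is minimal and contains an LR sequence (with some constant $K$). *)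

(* Defs.v *)
From HB Require Import structures.
From mathcomp Require Import all_boot all_order all_algebra.
From mathcomp Require Import all_classical all_reals all_analysis.

Set Implicit Arguments.
Unset Strict Implicit.
Unset Printing Implicit Defensive.

Import Order.TTheory GRing.Theory Num.Theory.

Local Open Scope classical_set_scope.
Local Open Scope ring_scope.

(* A^Z with the product topology, A being discrete. *)
Definition full_shift (A : finType) : topologicalType :=
  {ptws int -> discrete_topology A}.

Definition shift (A : finType) (x : full_shift A) : full_shift A :=
  fun n => x (n + 1).

Record subshift (A : finType) := Subshift {
  subshift_set :> set (full_shift A);
  subshift_closed : closed subshift_set;
  subshift_shift : @shift A @` subshift_set = subshift_set }.

Definition minimal (A : finType) (X : subshift A) : Prop :=
  forall Y : set (full_shift A), closed Y -> @shift A @` Y = Y ->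
    Y `<=` X -> Y !=set0 -> Y = X.

Section words.
Context (A : finType).
Implicit Types (x : full_shift A) (u v w : seq A) (i j : int).

Definition occurs_at x u i : Prop :=
  mkseq (fun k => x (i + k%:Z) : A) (size u) = u.

Definition language x : set (seq A) := [set u | exists i, occurs_at x u i].

Definition nb_occ u v : nat :=
  count (fun k => prefix u (drop k v)) (iota 0 (size v).+1).

Definition return_word x u w : Prop :=
  [/\ language x (w ++ u), prefix u (w ++ u) & nb_occ u (w ++ u) = 2%N].

Definition successive_occ x u i j : Prop :=
  [/\ i < j, occurs_at x u i, occurs_at x u j &
      forall k, i < k < j -> ~ occurs_at x u k].

(* The bound is vacuous for a word with only one occurrence in x. This makes
   no difference to linearly_recurrent below: if x lies in a minimal subshift,
   every word of its language occurs in x infinitely often in both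
   directions. *)
Definition uniformly_recurrent x : Prop :=
  forall u, language x u ->
    exists M : nat, forall i j, successive_occ x u i j -> j - i <= M%:Z.

Definition LR_sequence (K : nat) x : Prop :=
  uniformly_recurrent x /\
  forall u w, u <> [::] -> language x u -> return_word x u w ->
    (size w <= K * size u)%N.

End words.

Definition linearly_recurrent (A : finType) (X : subshift A) : Prop :=
  minimal X /\ exists x, subshift_set X x /\ exists K : nat, LR_sequence K x.

Lemma shift_subshift (A : finType) (X : subshift A) (x : set_type X) :
  shift (set_val x) \in subshift_set X.
Proof.
by apply/mem_set; have := imageP (@shift A) (set_valP x); rewrite subshift_shift.
Qed.

(* X as a topological space, with the subspace topology. Measurable types are
   pointed in the library, so a proof X0 that X is inhabited is carried along;
   neither the topology nor the Borel sets depend on the chosen point. *)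
Definition subshift_space (A : finType) (X : subshift A)
  (X0 : subshift_set X !=set0) : Type := set_type X.

Section subshift_space.
Context (A : finType) (X : subshift A) (X0 : subshift_set X !=set0).

HB.instance Definition _ := Topological.copy (subshift_space X0) (set_type X).
HB.instance Definition _ := isPointed.Build (subshift_space X0)
  (exist _ (sval (cid X0)) (mem_set (svalP (cid X0)))).

Definition subshift_map (x : subshift_space X0) : subshift_space X0 :=
  exist _ (shift (set_val x)) (shift_subshift x).

Definition borel : measurableType (@open (subshift_space X0)).-sigma :=
  g_sigma_algebraType (@open (subshift_space X0)).

Definition invariant_measure (R : realType) (mu : probability borel R) : Prop :=
  forall B : set borel, measurable B -> mu (subshift_map @^-1` B) = mu B.

End subshift_space.

(* In the library a measure is a function on all subsets, with unspecified
   values outside the sigma-algebra: two measures are identified when they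
   agree on measurable sets. Asking for X0 is no restriction, as an empty
   space carries no probability measure. *)
Definition uniquely_ergodic (R : realType) (A : finType) (X : subshift A) :
    Prop :=
  exists (X0 : subshift_set X !=set0) (mu : probability (borel X0) R),
    invariant_measure mu /\
    forall nu : probability (borel X0) R, invariant_measure nu ->
      forall B : set (borel X0), measurable B -> nu B = mu B.

(* Main.v *)
(** Every block of length l of a point of X occurs in every point of X with gaps
at most K l: place the block and a long window of the other point in the LR
sequence, and read the gap there as a return word. For a clopen C with visit
counts S_n, let a be the supremum of the slopes b with S_m >= b m uniformly for
some m > 0. Then S_n >= (a - d) n - O(1), while for each length some orbit
segment has average below a + d. Any orbit segment of length n recurs inside
such a segment of length O(n); removing it leaves two pieces that the lower
bound controls, so S_n <= (a + O(d)) n + O(1). Hence clopen sets have uniform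
frequencies. An invariant probability must give C its frequency, which yields
uniqueness; conversely the frequencies form a content on the algebra of clopen
sets, sigma-additive by compactness, whose Caratheodory extension is
invariant. *)
From HB Require Import structures.
Require Import Defs.
From mathcomp Require Import all_boot all_order all_algebra.
From mathcomp Require Import all_classical all_reals all_analysis.
From mathcomp Require Import measurable_realfun zify ring lra.

Set Implicit Arguments.
Unset Strict Implicit.
Unset Printing Implicit Defensive.

Import Order.TTheory GRing.Theory Num.Theory.

Local Open Scope classical_set_scope.
Local Open Scope ring_scope.

(** * Topology of the full shift *)

Section full_shift_topology.
Context (A : finType).
Implicit Types (y z : full_shift A) (r n : nat).

(** Closeness in the product topology, read on a central window: the sets [agree r y] form a
    neighbourhood basis at [y], and radius 0 imposes nothing. *)
Definition agree r y z : Prop := forall i : int, (`|i| < r)%N -> y i = z i.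

Lemma agree_sym r y z : agree r y z -> agree r z y.
Proof. by move=> yz i ir; rewrite yz. Qed.

Lemma agree_trans r y z t : agree r y z -> agree r z t -> agree r y t.
Proof. by move=> yz zt i ir; rewrite yz// zt. Qed.

Lemma agree_le r r' y z : (r <= r')%N -> agree r' y z -> agree r y z.
Proof. by move=> rr' yz i ir; apply: yz; exact: leq_trans rr'. Qed.

Lemma nbhs_coordinate y (i : int) : nbhs y [set z | y i = z i].
Proof.
have /cvg_sup/(_ i) : y --> y by exact: cvg_id.
apply; exists [set z : full_shift A | y i = z i]; split => //.
exists [set y i] => //; first exact: discrete_open.
by apply/seteqP; split => z /=.
Qed.

Lemma nbhs_agree r y : nbhs y (agree r y).
Proof.
elim: r => [|r IH]; first by apply: filterS filterT => z _ i.
apply: filterS (filterI IH (filterI (nbhs_coordinate y r%:Z)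
  (nbhs_coordinate y (- r%:Z)))) => z [yz [yzr yzNr]] i.
rewrite ltnS leq_eqVlt => /orP[/eqP ir|]; last exact: yz.
by have [->|->] : i = r%:Z \/ i = - r%:Z by lia.
Qed.

(** The cylinders around [y] are a filter base. The product topology is the supremum of the
    coordinate topologies, so this filter converges to [y] once it does so in each coordinate [i],
    where radius [|i| + 1] suffices. *)
Lemma nbhs_agreeP y (U : set (full_shift A)) :
  nbhs y U -> exists r, agree r y `<=` U.
Proof.
pose F := filter_from [set: nat] (fun r => agree r y).
have FF : Filter F.
  apply: filter_from_filter; first by exists 0%N.
  move=> r r' _ _; exists (maxn r r') => // z yz.
  by split; apply: agree_le yz; rewrite ?leq_maxl ?leq_maxr.
have : F --> y.
  apply/cvg_sup => i B [W [[V oV <-] /= Vy WB]].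
  exists `|i|.+1 => // z yz; apply: WB; rewrite /= -yz //.
by move=> /[apply] -[r _ rU]; exists r.
Qed.

Lemma full_shift_compact : compact [set: full_shift A].
Proof.
have := @tychonoff int (fun=> discrete_topology A) (fun=> setT).
rewrite (_ : [set _ | _] = setT); last by apply/seteqP; split.
by apply=> _; apply: finite_compact; exact: finite_finset.
Qed.

Lemma closed_agree (Y : set (full_shift A)) : closed Y <->
  forall y, (forall r, exists2 z, Y z & agree r y z) -> Y y.
Proof.
split=> [cY y yY|H].
  apply: cY => U /nbhs_agreeP[r rU].
  by have [z Yz yz] := yY r; exists z; split => //; exact: rU.
by move=> y /= cy; apply: H => r;
  have [z [Yz yz]] := cy _ (nbhs_agree r y); exists z.
Qed.

End full_shift_topology.

(** * Gaps between occurrences *)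

Section recurrence.
Context (A : finType).
Implicit Types (X : subshift A) (x y z : full_shift A) (r n l : nat).

Definition translate (m : int) x : full_shift A := fun i => x (i + m).

Lemma translate_subshift X x n : subshift_set X x ->
  subshift_set X (translate n%:Z x).
Proof.
move=> Xx; elim: n => [|n IH].
  rewrite (_ : translate _ _ = x)//; apply/funext => i.
  by rewrite /translate addr0.
rewrite -(subshift_shift X); exists (translate n%:Z x) => //.
by apply/funext => i; rewrite /Defs.shift/translate; congr (x _); lia.
Qed.

(** Asking for arbitrarily late translates makes this set equal to its image under the shift, as
    [minimal] demands; a forward orbit closure need only contain its image. *)
Definition omega_limit x : set (full_shift A) :=
  [set y | forall r N, exists2 n, (N <= n)%N & agree r y (translate n%:Z x)].

Lemma omega_limit_closed x : closed (omega_limit x).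
Proof.
apply/closed_agree => y yY r N; have [z zY yz] := yY r.
by have [n Nn zn] := zY r N; exists n => //; exact: agree_trans zn.
Qed.

Lemma omega_limit_shift x : @Defs.shift A @` omega_limit x = omega_limit x.
Proof.
apply/seteqP; split=> [_ [y yY <-] r N|y yY].
  have [n Nn yn] := yY r.+1 N.+1; exists n.+1; first by lia.
  move=> i ir; rewrite /Defs.shift yn; last by lia.
  by rewrite /translate; congr (x _); lia.
exists (translate (-1) y); last first.
  by apply/funext => i; rewrite /Defs.shift/translate; congr (y _); lia.
(* The larger radius makes room for the displaced coordinate, and [N.+1] keeps [n] positive, so that
   [n.-1] is a true predecessor. *)
move=> r N; have [n Nn yn] := yY r.+1 N.+1; exists n.-1; first by lia.
move=> i ir; rewrite /translate yn; last by lia.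
by rewrite /translate; congr (x _); lia.
Qed.

Lemma omega_limit_sub X x : subshift_set X x -> omega_limit x `<=` X.
Proof.
move=> Xx y yY; apply: (closed_agree X).1 => [|r]; first exact: subshift_closed.
have [n _ yn] := yY r 0%N; exists (translate n%:Z x) => //.
exact: translate_subshift.
Qed.

Lemma omega_limit_nonempty x : omega_limit x !=set0.
Proof.
have := @full_shift_compact A ((fun n : nat => translate n%:Z x) @ \oo).
case=> [|y [_ yx]]; first exact: filterT.
exists y => r N; have [||z [[n /= Nn <-] yn]] :=
  yx [set translate n%:Z x | n in [set n | (N <= n)%N]] (agree r y).
- by exists N => // n /= Nn; exists n.
- exact: nbhs_agree.
- by exists n.
Qed.

Lemma minimal_omega_limit X x :
  minimal X -> subshift_set X x -> omega_limit x = X.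
Proof.
move=> mX Xx; apply: mX.
- exact: omega_limit_closed.
- exact: omega_limit_shift.
- exact: omega_limit_sub.
- exact: omega_limit_nonempty.
Qed.

Lemma minimal_occurrence X x y (s : int) l N :
  minimal X -> subshift_set X x -> subshift_set X y ->
  exists2 n, (N <= n)%N &
    forall k, (k < l)%N -> y (s + k%:Z) = x (n%:Z + k%:Z).
Proof.
move=> mX Xx; rewrite -(minimal_omega_limit mX Xx) => yY.
(* Radius [|s| + l] covers the block starting at [s]. As [n] is at least [N + |s|], the position
   [n + s] is at least [N], and the absolute value below merely turns it into a natural number. *)
have [n Nn yn] := yY (`|s| + l)%N (N + `|s|)%N.
exists `|(n%:Z + s)%R|%N; first by lia.
by move=> k kl; rewrite yn ?/translate; [congr (x _)|]; lia.
Qed.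

Lemma successive_return_word x u (p d : nat) : u <> [::] -> (0 < d)%N ->
  occurs_at x u p%:Z -> occurs_at x u (p + d)%:Z ->
  (forall k, (0 < k < d)%N -> ~ occurs_at x u (p + k)%:Z) ->
  return_word x u (mkseq (fun k => x (p + k)%:Z : A) d).
Proof.
move=> un0 d0 op oq npq; have szu : (0 < size u)%N by case: (u) un0.
have vE : mkseq (fun k => x (p + k)%:Z : A) d ++ u =
    mkseq (fun k => x (p + k)%:Z : A) (d + size u).
  rewrite /mkseq iotaD map_cat; congr (_ ++ _); rewrite -[LHS]oq /mkseq.
  rewrite (addnC 0%N) iotaDl -map_comp; apply: eq_map => k /=.
  by congr (x _); lia.
have prefixP k : (k <= d)%N ->
    prefix u (drop k (mkseq (fun k => x (p + k)%:Z : A) (d + size u))) <->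
    occurs_at x u (p + k)%:Z.
  move=> kd; rewrite prefixE /mkseq -map_drop -map_take.
  rewrite drop_iota take_iota add0n.
  rewrite (_ : minn _ _ = size u); last first.
    by apply/minn_idPl; rewrite -addnBAC// leq_addl.
  rewrite -[k in iota k _]addn0 iotaDl -map_comp /occurs_at /mkseq.
  rewrite (_ : [seq _ | i <- _] =
    [seq x ((p + k)%:Z + i%:Z) | i <- iota 0 (size u)]).
    by split=> /eqP.
  by apply: eq_map => i /=; congr (x _); lia.
rewrite /return_word /nb_occ !vE; split.
- exists p%:Z; rewrite /occurs_at size_mkseq.
  by apply: eq_map => k; congr (x _); lia.
- by have /prefixP := leq0n d; rewrite drop0 addn0 => ->.
(* Beyond position [d] too few letters remain for [u], so only 0 and [d] are counted. *)
- rewrite size_mkseq (@eq_in_count _ _ (predU (pred1 0%N) (pred1 d))); last first.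
    move=> k; rewrite mem_iota /= => kl; apply/idP/idP; last first.
      by case/orP => /eqP ->; apply/prefixP => //; rewrite addn0.
    have [kd|dk] := leqP k d.
      move/(prefixP _ kd) => ok; case: (posnP k) => [//|k0].
      by case: ltngtP kd => // kd; have := npq k; rewrite k0 kd; case.
    move/size_prefix; rewrite size_drop size_mkseq => h.
    by have {h} : (size u <= d + size u - k)%N by []; lia.
  have := count_predUI (pred1 0%N) (pred1 d) (iota 0 (d + size u).+1).
  rewrite !count_uniq_mem ?iota_uniq// !mem_iota.
  rewrite (@eq_count _ (predI _ _) pred0) ?count_pred0; first by lia.
  by move=> k /=; apply/negbTE; lia.
Qed.

(** Everything is compared inside [x]: if a window of [z] is copied at [i], and [p <= i < q] are the
    occurrences of the block of [y] around [i], then [q - p] is the length of a return word and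
    bounds [q - i]. *)
Lemma LR_gap X x K y z (s : int) l :
  minimal X -> subshift_set X x -> LR_sequence K x ->
  subshift_set X y -> subshift_set X z -> (0 < l)%N ->
  exists2 j, (j <= K * l)%N &
    forall k, (k < l)%N -> z (s + (j + k)%:Z) = y (s + k%:Z).
Proof.
move=> mX Xx [_ LR] Xy Xz l0.
pose u : seq A := mkseq (fun k => y (s + k%:Z) : A) l.
have szu : size u = l by rewrite size_mkseq.
have un0 : u <> [::] by move=> u0; move: szu l0; rewrite u0/= => <-.
have occE n : occurs_at x u n%:Z <->
    forall k, (k < l)%N -> y (s + k%:Z) = x (n%:Z + k%:Z).
  rewrite /occurs_at szu; split=> [e k kl|e].
    have /(congr1 (fun v => nth (y (s + k%:Z) : A) v k)) := e.
    by rewrite !nth_mkseq.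
  by apply/eq_in_map => k; rewrite mem_iota/= => kl; rewrite -e.
(* The occurrences [p0] and [q0] on either side of [i] guarantee that [p] and [q] exist. Length
   [K * l + l] lets the window contain the whole occurrence at [q]. *)
have [p0 _ /occE op0] := minimal_occurrence s l 0 mX Xx Xy.
have [i p0i zi] := minimal_occurrence s (K * l + l)%N p0 mX Xx Xz.
have [q0 iq0 /occE oq0] := minimal_occurrence s l i.+1 mX Xx Xy.
pose P n := `[< occurs_at x u n%:Z >].
have exq : exists q, (i < q)%N && P q by exists q0; rewrite iq0; exact/asboolP.
have [q /andP[iq /asboolP oq] qmin] := ex_minnP exq.
have exp : exists p, (p <= i)%N && P p by exists p0; rewrite p0i; exact/asboolP.
have [|p /andP[pi /asboolP op] pmax] := ex_maxnP exp (m := i).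
  by move=> p /andP[].
have /(LR _ _ un0 (ex_intro _ _ op)) :
    return_word x u (mkseq (fun k => x (p + k)%:Z : A) (q - p)).
  apply: successive_return_word => //; [lia|by rewrite subnKC//; lia|].
  move=> k kqp /asboolP Pk; have [pki|ipk] := leqP (p + k) i.
    by have := pmax (p + k)%N; rewrite /P Pk pki => /(_ isT); lia.
  by have := qmin (p + k)%N; rewrite /P Pk ipk => /(_ isT); lia.
rewrite size_mkseq szu => qpK; exists (q - i)%N; first by lia.
move=> k kl; rewrite zi; last by lia.
by rewrite ((occE _).1 oq)//; congr (x _); lia.
Qed.

End recurrence.

(** * Uniform frequencies *)

Section frequency.
Context (R : realType) (T : Type) (f : T -> T).
Implicit Types (C D : set T) (y z : T) (n : nat) (a : R).

Definition visits C n y : R := \sum_(k < n) \1_C (iter k f y).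

Lemma visitsD C n m y :
  visits C (n + m) y = visits C n y + visits C m (iter n f y).
Proof.
rewrite /visits big_split_ord/=; congr (_ + _); apply: eq_bigr => k _.
by rewrite addnC iterD.
Qed.

Lemma visits_ge0 C n y : 0 <= visits C n y.
Proof. by apply: sumr_ge0 => k _; rewrite indicE. Qed.

Lemma visits_le C n y : visits C n y <= n%:R.
Proof.
rewrite -[n in n%:R]card_ord -sumr_const; apply: ler_sum => k _.
by rewrite indicE lern1 leq_b1.
Qed.

Definition has_frequency C a := forall e : R, 0 < e -> exists N, forall n y,
  (N <= n)%N -> `|visits C n y - a * n%:R| <= e * n%:R.

(** The constant [c] allows for sets that depend on several coordinates: [n] successive visits are
    then read off a block slightly longer than [n]. *)
Definition linearly_revisited C := exists K c, forall n y z, (0 < n)%N ->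
  exists2 j, (j <= K * (n + c))%N &
    forall k, (k < n)%N -> C (iter (j + k) f z) <-> C (iter k f y).

Lemma linearly_revisited_frequency C : T -> linearly_revisited C ->
  exists a, has_frequency C a.
Proof.
move=> t0 [K [c LC]].
pose E : set R :=
  [set b | exists2 n, (0 < n)%N & forall y, b * n%:R <= visits C n y].
have E1 b : E b -> b <= 1.
  case=> n n0 /(_ t0)/le_trans/(_ (visits_le _ _ _)).
  by rewrite -ler_pdivlMr ?ltr0n// divff// pnatr_eq0 -lt0n.
have supE : has_sup E.
  split; last by exists 1 => b /E1.
  by exists 0, 1%N => // y; rewrite mul0r visits_ge0.
pose a := sup E.
have lower d : 0 < d -> exists m : nat, forall n y,
    (a - d) * n%:R - m%:R <= visits C n y.
  (* Cut the segment into blocks of length [m], each with average at least [b > a - d]. The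
     remainder is shorter than [m] and [b <= 1], so it costs at most [m]. *)
  move=> d0; have [b Eb ab] := sup_adherent d0 supE.
  have b1 := E1 _ Eb; case: Eb => m m0 bm; exists m => n y.
  have qb q z : b * (q * m)%:R <= visits C (q * m) z.
    elim: q z => [|q IH] z; first by rewrite mul0n mulr0 visits_ge0.
    by rewrite mulSn natrD mulrDr visitsD lerD.
  rewrite (divn_eq n m) visitsD.
  have := qb (n %/ m)%N y.
  have := visits_ge0 C (n %% m) (iter (n %/ m * m) f y).
  have : (n %% m)%:R <= m%:R :> R by rewrite ler_nat ltnW// ltn_pmod.
  have := ler0n R (n %% m); have := ler0n R (n %/ m * m); rewrite natrD -/a.
  move: (_ %:R) (_ %:R) (m%:R) (visits _ _ _) (visits _ _ _) => u v w s t.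
  move: ab; rewrite -/a; nra.
(* The final estimate has error [(4 * K + 1) * d * n + 2 * m]; this [d] makes the first term
   [e / 2 * n], and [n >= 4 * m / e] bounds the second by the same amount. *)
exists a => e e0; pose d := e / (2 * (4 * K + 1)%:R).
have d0 : 0 < d by rewrite divr_gt0// mulr_gt0// ltr0n addn1.
have [m hm] := lower d d0.
exists (maxn c (Num.truncn (4 * m%:R / e)).+1) => n y.
rewrite geq_max => /andP[cn mn]; have n0 : (0 < n)%N by exact: leq_trans mn.
have {}mn : 4 * m%:R <= e * n%:R.
  rewrite -ler_pdivrMl// mulrC; apply/ltW/(lt_le_trans (truncnS_gt _)).
  by rewrite ler_nat.
have dE : (4 * K%:R + 1) * d = e / 2.
  rewrite /d natrD natrM; field.
  by rewrite -(natrM R 4 K) natr1 pnatr_eq0.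
have dn : d * n%:R <= e / 2 * n%:R.
  by rewrite ler_wpM2r// -dE mulrDl mul1r lerDr !mulr_ge0// ltW.
rewrite ler_norml; apply/andP; split.
  by have := hm n y; have := ler0n R m; lra.
pose L := (K * (n + c))%N.
(* Otherwise [a + d] would be a slope in [E], above its supremum. *)
have [z Lz] : exists z, visits C (L + n) z < (a + d) * (L + n)%:R.
  apply: contrapT => /forallNP nE; have /(ub_le_sup supE.2) : E (a + d).
    exists (L + n)%N; first by rewrite addn_gt0 n0 orbT.
    by move=> z; rewrite leNgt; apply/negP; exact: nE.
  by rewrite -/a gerDl leNgt d0.
have [j jL Cj] := LC n y z n0.
have zy : visits C n (iter j f z) = visits C n y.
  apply: eq_bigr => k _; rewrite -iterD addnC !indicE; congr (nat_of_bool _)%:R.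
  by apply/idP/idP => /set_mem /(Cj _ (ltn_ord k)) /mem_set.
(* The copy of the segment of [y] starts at [j <= L], hence lies inside the sparse segment of [z];
   the outer pieces have lengths [j] and [L - j], and [n >= c] gives [L <= 2 * K * n]. *)
have Ln : (L + n = j + (n + (L - j)))%N by lia.
move: Lz; rewrite {1}Ln !visitsD zy.
have := hm j z; have := hm (L - j)%N (iter n f (iter j f z)).
rewrite natrB// !natrD.
have : L%:R <= 2 * K%:R * n%:R :> R by rewrite -!natrM ler_nat /L; nia.
move: dE mn dn d0; move: (visits _ _ _) (visits _ _ _) (visits _ _ _).
move: (L%:R) (n%:R) (m%:R) (K%:R) (j%:R) => L' n' m' K' j' u v w.
move=> dE mn dn d0' /(ler_wpM2l (ltW d0')) dL.
have {dE} : (4 * K' + 1) * d * n' = e / 2 * n' by rewrite dE.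
lra.
Qed.

End frequency.

Section frequency_algebra.
Context (R : realType) (T : Type) (f : T -> T).
Implicit Types (C D : set T) (a b : R).

Lemma has_frequency_ge0 C a : T -> has_frequency f C a -> 0 <= a.
Proof.
move=> t0 Ca; apply/ler_addgt0Pr => e e0; have [N HN] := Ca e e0.
have := HN N.+1 t0 (leqnSn N); rewrite ler_norml => /andP[_].
have : 0 < N.+1%:R :> R by [].
have := visits_ge0 R f C N.+1 t0; move: (visits _ _ _ _ _) (_%:R) => v w.
nra.
Qed.

Lemma has_frequency_unique C a b : T ->
  has_frequency f C a -> has_frequency f C b -> a = b.
Proof.
move=> t0.
suff le a' b' : has_frequency f C a' -> has_frequency f C b' -> a' <= b'.
  by move=> Ca Cb; apply/eqP; rewrite eq_le !le.
move=> Ca Cb; apply/ler_addgt0Pr => e e0.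
have e20 : 0 < e / 2 by rewrite divr_gt0.
have [N HN] := Ca _ e20; have [M HM] := Cb _ e20.
have := HN (maxn N M).+1 t0 (leqW (leq_maxl _ _)).
have := HM (maxn N M).+1 t0 (leqW (leq_maxr _ _)).
rewrite !ler_norml => /andP[_ +] /andP[+ _].
have : 0 < (maxn N M).+1%:R :> R by [].
by move: (visits _ _ _ _ _) (_%:R) => v w; nra.
Qed.

Lemma has_frequencyT : has_frequency f setT (1 : R).
Proof.
move=> e e0; exists 0%N => n y _; rewrite /visits (eq_bigr (fun=> 1)) => [|k _].
  by rewrite sumr_const card_ord mul1r subrr normr0 mulr_ge0// ltW.
by rewrite indicT.
Qed.

Lemma has_frequencyU C D a b : C `&` D = set0 ->
  has_frequency f C a -> has_frequency f D b ->
  has_frequency f (C `|` D) (a + b).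
Proof.
move=> CD0 Ca Db e e0; have e20 : 0 < e / 2 by rewrite divr_gt0.
have [N HN] := Ca _ e20; have [M HM] := Db _ e20.
exists (maxn N M) => n y; rewrite geq_max => /andP[Nn Mn].
have -> : visits R f (C `|` D) n y = visits R f C n y + visits R f D n y.
  rewrite /visits -big_split/=; apply: eq_bigr => k _; rewrite !indicE in_setU.
  have [kC|] := boolP (_ \in C); last by rewrite add0r.
  rewrite (_ : _ \in D = false) ?addr0//; apply/negbTE/negP => kD.
  by have : (C `&` D) (iter k f y); [split; exact/set_mem|rewrite CD0].
have := HN n y Nn; have := HM n y Mn.
by rewrite !ler_norml => /andP[? ?] /andP[? ?]; lra.
Qed.

Lemma has_frequencyC C a :
  has_frequency f C a -> has_frequency f (~` C) (1 - a).
Proof.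
move=> Ca e e0; have [N HN] := Ca _ e0; exists N => n y /(HN _ y).
have -> : visits R f (~` C) n y = n%:R - visits R f C n y.
  rewrite -[n in n%:R]card_ord -sumr_const -sumrB; apply: eq_bigr => k _.
  by rewrite !indicE in_setC; case: (_ \in _); rewrite ?subrr ?subr0.
by rewrite (_ : _ - _ - _ = - (visits R f C n y - a * n%:R)) ?normrN//; lra.
Qed.

Lemma has_frequency_preimage C a :
  has_frequency f C a -> has_frequency f (f @^-1` C) a.
Proof.
move=> Ca e e0; have [N HN] := Ca _ e0; exists N => n y Nn.
have -> : visits R f (f @^-1` C) n y = visits R f C n (f y).
  by apply: eq_bigr => k _; rewrite -iterSr.
exact: HN.
Qed.

End frequency_algebra.

(** * Invariant measures *)

Section invariant_frequency.
Context d (T : measurableType d) (R : realType) (f : T -> T).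

(** By invariance the integral of the visit count over [n] steps is [n * mu C], while the count is
    uniformly close to [a * n]. *)
Lemma invariant_measure_frequency (mu : probability T R) C a :
  measurable_fun setT f ->
  (forall B, measurable B -> mu (f @^-1` B) = mu B) ->
  measurable C -> has_frequency f C a -> mu C = a%:E.
Proof.
move=> mf inv mC Ca.
have miter k B : measurable B -> measurable (iter k f @^-1` B) /\
    mu (iter k f @^-1` B) = mu B.
  elim: k B => [//|k IH] B mB.
  have mfB : measurable (f @^-1` B).
    by rewrite -[X in measurable X]setTI; exact: mf.
  have [m1 m2] := IH _ mfB; split; first exact: m1.
  by rewrite -(inv _ mB) -m2.
(* An upper bound for all sets is enough: applied to the complement, of frequency [1 - a], it yields
   the lower bound. *)
suff le B b : measurable B -> has_frequency f B b -> (mu B <= b%:E)%E.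
  apply/eqP; rewrite eq_le le//=.
  have := le _ _ (measurableC mC) (has_frequencyC Ca).
  rewrite probability_setC//; have /fineK <- := fin_num_measure mu _ mC.
  by rewrite -EFinB !lee_fin; lra.
move=> mB Bb; apply/lee_addgt0Pr => e e0; have [N /(_ N.+1)HN] := Bb e e0.
have : (\int[mu]_x (visits R f B N.+1 x)%:E <= ((b + e) * N.+1%:R)%:E)%E.
  rewrite -[leRHS]mule1 -(probability_setT mu) -integral_cst//.
  apply: ge0_le_integral => //.
  - by move=> x _; rewrite lee_fin visits_ge0.
  - apply/measurable_EFinP/measurable_sum => k.
    by apply: measurable_indic; exact: (miter k B mB).1.
  - move=> x _; rewrite lee_fin.
    by have := HN x (leqnSn N); rewrite ler_norml => /andP[_]; lra.
have -> : (\int[mu]_x (visits R f B N.+1 x)%:E = N.+1%:R%:E * mu B)%E.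
  under eq_integral do rewrite /visits -sumEFin.
  rewrite ge0_integral_sum//; last first.
    move=> k; apply/measurable_EFinP.
    by apply: measurable_indic; exact: (miter k B mB).1.
  rewrite (eq_bigr (fun=> mu B)) => [|k _].
    by rewrite mule_natl /enatmul Monoid.iteropE big_const_ord.
  have [mkB <-] := miter k B mB.
  by rewrite -[iter k f @^-1` B in RHS]setIT -integral_indic.
have /fineK <- := fin_num_measure mu _ mB.
by rewrite -EFinM lee_fin -EFinD lee_fin mulrC ler_pM2r.
Qed.

End invariant_frequency.

(** * The algebra of clopen sets *)

Section local_sets.
Context (A : finType) (X : subshift A) (X0 : subshift_set X !=set0).
Notation Y := (subshift_space X0).
Implicit Types (C D : set Y) (y z : Y).

Definition local : set (set Y) :=
  [set C | exists r, forall y z, agree r (set_val y) (set_val z) -> C y -> C z].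

Lemma local0 : local set0.
Proof. by exists 0%N. Qed.

Lemma localC : setC_closed local.
Proof. by move=> C [r Cr]; exists r => y z /agree_sym yz Cy /(Cr _ _ yz). Qed.

Lemma localU : setU_closed local.
Proof.
move=> C D [r Cr] [s Ds]; exists (maxn r s) => y z yz [Cy|Dy]; [left|right].
  by apply: Cr Cy; apply: agree_le yz; rewrite leq_maxl.
by apply: Ds Dy; apply: agree_le yz; rewrite leq_maxr.
Qed.

Lemma localI : setI_closed local.
Proof.
move=> C D lC lD; rewrite -[C `&` D]setCK setCI.
by apply/localC/localU; exact: localC.
Qed.

Lemma local_preimage C : local C -> local (@subshift_map _ _ X0 @^-1` C).
Proof.
move=> [r Cr]; exists r.+1 => y z yz; apply: Cr => i ir.
by apply: yz; lia.
Qed.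

Lemma local_open C : local C -> open C.
Proof.
move=> [r Cr]; rewrite openE => y Cy.
have : nbhs y (set_val @^-1` agree r (set_val y)).
  exact: (@initial_continuous _ _ set_val y _ (nbhs_agree r (set_val y))).
by apply: filterS => z yz; exact: Cr Cy.
Qed.

(** Take for [F r] the points whose cylinder of radius [r] stays in [C]. The union being countable,
    local sets generate the Borel sets. *)
Lemma open_bigcup_local C : open C -> exists2 F : (set Y)^nat,
  (forall r, local (F r)) & C = \bigcup_r F r.
Proof.
move=> oC; exists (fun r =>
    [set y | forall z : Y, agree r (set_val y) (set_val z) -> C z]).
  by move=> r; exists r => y z yz Cy t zt; apply: Cy; exact: agree_trans zt.
apply/seteqP; split => [y Cy|y [r _]]; last by apply.
case: oC Cy => U oU <- Uy.
have [r rU] := nbhs_agreeP (open_nbhs_nbhs (conj oU Uy)).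
by exists r => // z yz; exact: rU.
Qed.

Lemma borel_local : (@measurable _ (borel X0)) = <<s local >>.
Proof.
apply/seteqP; split; apply: smallest_sub.
- exact: smallest_sigma_algebra.
- move=> C /open_bigcup_local[F lF ->].
  apply: (@bigcup_measurable _ (g_sigma_algebraType local)) => r _.
  exact: sub_sigma_algebra.
- exact: smallest_sigma_algebra.
- by move=> C /local_open oC; exact: sub_sigma_algebra.
Qed.

Lemma local_measurable C : local C -> measurable (C : set (borel X0)).
Proof. by rewrite borel_local => lC; exact: sub_sigma_algebra. Qed.

Lemma subshift_map_measurable :
  @measurable_fun _ _ (borel X0) (borel X0) setT (@subshift_map _ _ X0).
Proof.
apply: (@measurability _ _ (borel X0) (borel X0) _ _ local).
  exact: borel_local.
move=> _ [C lC <-]; rewrite setTI.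
by apply: local_measurable; exact: local_preimage.
Qed.

Lemma local_measure_unique (R : realType) (mu nu : probability (borel X0) R) :
  (forall C, local C -> mu C = nu C) ->
  forall B : set (borel X0), measurable B -> mu B = nu B.
Proof.
move=> munu B.
apply: (@measure_unique _ R (borel X0) local (fun=> setT) _ _ _ _ mu nu).
- exact: borel_local.
- exact: localI.
- by move=> _; rewrite -setC0; exact/localC/local0.
- by rewrite bigcup_const.
- exact: munu.
- by move=> _ /=; rewrite probability_setT ltry.
Qed.

(** If no finite union covers [C], choose [u n] in [C] outside the first [n] sets. A cluster point
    lies in [C], hence in some [F i]; being local, [F i] then contains some [u n] with [n > i]. *)
Lemma local_compact C (F : (set Y)^nat) : local C -> (forall i, local (F i)) ->
  C `<=` \bigcup_i F i -> exists n, C `<=` \big[setU/set0]_(i < n) F i.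
Proof.
move=> [r Cr] lF CF; apply: contrapT => /forallNP nC.
have /choice[u uP] n : exists y, C y /\ forall i, (i < n)%N -> ~ F i y.
  have /existsNP[y /not_implyP[Cy nFy]] := nC n.
  by exists y; split=> // i ni Fiy; apply: nFy; rewrite -bigcup_mkord; exists i.
have [|p [_ pu]] := @full_shift_compact A (set_val \o u @ \oo).
  exact: filterT.
have near_p s N : exists2 n, (N <= n)%N & agree s p (set_val (u n)).
  have [||_ [[n Nn <-] pn]] :=
      pu [set set_val (u n) | n in [set n | (N <= n)%N]] (agree s p).
  - by exists N => // n /= Nn; exists n.
  - exact: nbhs_agree.
  - by exists n.
have Xp : subshift_set X p.
  apply: (closed_agree X).1 => [|s]; first exact: subshift_closed.
  have [n _ pn] := near_p s 0%N; exists (set_val (u n)) => //; exact: set_valP.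
pose y : Y := exist _ p (mem_set Xp).
have Cy : C y.
  by have [n _ /agree_sym pn] := near_p r 0%N; exact: (Cr (u n) y pn (uP n).1).
have [i _ Fiy] := CF _ Cy; have [s Fis] := lF i.
have [n ni pn] := near_p s i.+1.
by apply: ((uP n).2 i ni); exact: (Fis y (u n) pn Fiy).
Qed.

End local_sets.

(** * Extension of the frequency to a Borel probability *)

Section local_space.
Context (A : finType) (X : subshift A) (X0 : subshift_set X !=set0).

(** A copy of the space whose measurable sets are the local ones, so that the frequency can be a
    content on this algebra while [borel] keeps the sigma-algebra. *)
Definition local_space : Type := subshift_space X0.

HB.instance Definition _ := Pointed.copy local_space (subshift_space X0).
HB.instance Definition _ := isAlgebraOfSets.Build default_measure_display
  local_space (@local0 _ _ X0) (@localU _ _ X0) (@localC _ _ X0).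

End local_space.

Section frequency_measure.
Context (R : realType) (A : finType) (X : subshift A)
  (X0 : subshift_set X !=set0).
Local Notation f := (@subshift_map _ _ X0).
Local Notation local := (@local A X X0).
Context (freq : forall C, local C -> exists a : R, has_frequency f C a).

(** The value 0 off the algebra is a default; on it, uniqueness of frequencies makes the choice
    immaterial. *)
Definition frequency (C : set (local_space X0)) : \bar R :=
  if pselect (local C) is left lC then (sval (cid (freq lC)))%:E else 0%E.

Lemma frequencyP C :
  local C -> exists2 a, has_frequency f C a & frequency C = a%:E.
Proof.
rewrite /frequency => lC; case: pselect => // lC'.
by exists (sval (cid (freq lC'))) => //; case: cid.
Qed.

Lemma frequencyE C a : local C -> has_frequency f C a -> frequency C = a%:E.
Proof.
move=> /frequencyP[b Cb ->] Ca.
by rewrite (has_frequency_unique (point : subshift_space X0) Ca Cb).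
Qed.

Let frequency_ge0 C : (0 <= frequency C)%E.
Proof.
rewrite /frequency; case: pselect => // lC.
rewrite lee_fin; case: cid => a /= Ca.
exact: has_frequency_ge0 (point : subshift_space X0) Ca.
Qed.

Let frequency_semi_additive : measure_function.semi_additive frequency.
Proof.
have freq0 : frequency set0 = 0%E.
  apply: frequencyE; first exact: local0.
  by rewrite -setCT -(subrr 1); apply: has_frequencyC; exact: has_frequencyT.
have lbig (F : nat -> set (local_space X0)) n : (forall k, local (F k)) ->
    local (\big[setU/set0]_(k < n) F k).
  move=> lF; apply: big_ind => [||i _];
    by [apply: local0|apply: localU|apply: lF].
move=> F n lF tF _; elim: n => [|n IH]; first by rewrite !big_ord0.
rewrite !big_ord_recr/= -IH.
have [a Fa ->] := frequencyP (lbig F n lF); have [b Fb ->] := frequencyP (lF n).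
rewrite -EFinD; apply: frequencyE.
  by apply: localU; [exact: lbig|exact: lF].
apply: has_frequencyU => //; rewrite -bigcup_mkord setI_bigcupl.
rewrite bigcup0// => i /= ni.
by move/trivIsetP : tF; apply => //; rewrite neq_ltn ni.
Qed.

HB.instance Definition _ := isContent.Build _ _ _ frequency
  frequency_ge0 frequency_semi_additive.

(** Compactness reduces a countable cover to a finite one, where additivity of the content
    suffices. *)
Let frequency_sigma_subadditive : measurable_subset_sigma_subadditive frequency.
Proof.
move=> C F lF lC /(local_compact lC lF)[n CF].
apply: (@le_trans _ _ (\sum_(0 <= i < n) frequency (F i))%E); last first.
  exact: nneseries_lim_ge.
by rewrite big_mkord; apply: content_subadditive.
Qed.

HB.instance Definition _ := Content_SigmaSubAdditive_isMeasure.Build _ _ _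
  frequency frequency_sigma_subadditive.

(** The extension lives on the sigma-algebra generated by local sets; [borel_local] identifies it
    with the Borel one, to which the measure structure is transported. *)
Definition frequency_measure : set (borel X0) -> \bar R :=
  measure_extension frequency.

Lemma frequency_measureE (C : set (borel X0)) :
  local C -> frequency_measure C = frequency C.
Proof. by move=> lC; exact: (measurable_mu_extE frequency lC). Qed.

Let frequency_measure0 : frequency_measure set0 = 0%E.
Proof. exact: measure0 (measure_extension frequency). Qed.

Let frequency_measure_ge0 B : (0 <= frequency_measure B)%E.
Proof. exact: measure_ge0 (measure_extension frequency) B. Qed.

Let frequency_measure_semi_sigma_additive :
  semi_sigma_additive frequency_measure.
Proof.
move=> F mF tF mUF.
apply: (@measure_semi_sigma_additive _ _ _ (measure_extension frequency) F)
  => //.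
  by move=> i; have := mF i; rewrite borel_local.
by rewrite borel_local in mUF.
Qed.

HB.instance Definition _ := isMeasure.Build _ (borel X0) R frequency_measure
  frequency_measure0 frequency_measure_ge0
  frequency_measure_semi_sigma_additive.

Let frequency_measure_setT : frequency_measure setT = 1%E.
Proof.
have lT : local [set: subshift_space X0] by rewrite -setC0; exact/localC/local0.
by rewrite frequency_measureE//; apply: frequencyE => //; exact: has_frequencyT.
Qed.

HB.instance Definition _ := Measure_isProbability.Build _ (borel X0) R
  frequency_measure frequency_measure_setT.

End frequency_measure.

(** * From linear recurrence to unique ergodicity *)

Lemma iter_subshift_map (A : finType) (X : subshift A)
    (X0 : subshift_set X !=set0) n (y : subshift_space X0) :
  set_val (iter n (@subshift_map _ _ X0) y) = translate n%:Z (set_val y).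
Proof.
elim: n => [|n IH]; first by apply/funext => i; rewrite /translate addr0.
apply/funext => i; rewrite iterS /= {1}/set_val/= /Defs.shift IH /translate.
by congr (set_val y _); lia.
Qed.

Lemma linearly_recurrent_revisited (A : finType) (X : subshift A)
    (X0 : subshift_set X !=set0) (C : set (subshift_space X0)) :
  linearly_recurrent X -> local C ->
  linearly_revisited (@subshift_map _ _ X0) C.
Proof.
(* The first [n] visits to [C] depend only on coordinates between [-r] and [n + r], whence
   [c = r + r] and a block starting at [-r]. *)
move=> [mX [x [Xx [K LRx]]]] [r Cr]; exists K, (r + r)%N => n y z n0.
have [|j jK zy] := @LR_gap A X x K (set_val y) (set_val z) (- r%:Z)
  (n + (r + r)) mX Xx LRx (set_valP y) (set_valP z); first by lia.
exists j => // k kn.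
have agr : agree r (set_val (iter (j + k) (@subshift_map _ _ X0) z))
    (set_val (iter k (@subshift_map _ _ X0) y)).
  move=> i ir; rewrite !iter_subshift_map /translate.
  pose m := `|(i + r%:Z + k%:Z)%R|%N.
  have := zy m.
  rewrite (_ : (- r%:Z + (j + m)%:Z) = i + (j + k)%:Z); last by lia.
  by rewrite (_ : (- r%:Z + m%:Z) = i + k%:Z); [apply|]; lia.
by split; apply: Cr => //; exact: agree_sym.
Qed.

Theorem theorem15 (R : realType) (A : finType) (X : subshift A) :
  linearly_recurrent X -> uniquely_ergodic R X.
Proof.
move=> LX; have [_ [x [Xx _]]] := LX.
have X0 : subshift_set X !=set0 by exists x.
have freq C : local C -> exists a : R, has_frequency (@subshift_map _ _ X0) C a.
  move=> lC; apply: linearly_revisited_frequency.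
    exact: (point : subshift_space X0).
  exact: linearly_recurrent_revisited.
have freq_invariant (nu : probability (borel X0) R) : invariant_measure nu ->
    forall C, local C -> nu C = frequency freq C.
  move=> inv C lC; have [a Ca ->] := frequencyP freq lC.
  exact: (@invariant_measure_frequency _ (borel X0) R _ nu C a
    (@subshift_map_measurable _ _ X0) inv (local_measurable lC) Ca).
exists X0, (frequency_measure freq); split; last first.
  move=> nu inv; apply: local_measure_unique => C lC.
  by rewrite freq_invariant//; exact/esym/frequency_measureE.
(* Invariance is uniqueness again: the image measure under the shift is a probability, and it agrees
   with the original on local sets because a preimage keeps its frequency. *)
pose T : {mfun borel X0 >-> borel X0} :=
  mfun_Sub (mem_set (@subshift_map_measurable _ _ X0)).
apply: (@local_measure_unique _ _ _ _
  (distribution (frequency_measure freq) T)).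
move=> C lC; have lTC := local_preimage lC.
have [a Ca] := frequencyP freq lC.
rewrite -(frequencyE freq lTC (has_frequency_preimage Ca)) => freqC.
transitivity (frequency freq C); first by rewrite freqC; exact: frequency_measureE.
exact/esym/frequency_measureE.
Qed.
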